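(* For any real numbers $0\le a\le b$, there exist a $\mathbb{Z}$-action $(X,\mathbb{Z})$ and a compatible metric $d$ on $X$ such that, for every $\varepsilon\in(0,1)$ and the F\o lner sequence $F_n=\{0,1,\dots,n-1\}$, $n\in\mathbb{N}$, $$\overline{D}_{\mathrm{int}}(X,\varepsilon,\{F_n\}_{n\in\mathbb{N}},d)=1+b,\qquad \underline{D}_{\mathrm{int}}(X,\varepsilon,\{F_n\}_{n\in\mathbb{N}},d)=1+a,$$ $$\overline{D}_{\mathrm{ext}}(X,\varepsilon,\{F_n\}_{n\in\mathbb{N}},d)=b,\qquad \underline{D}_{\mathrm{ext}}(X,\varepsilon,\{F_n\}_{n\in\mathbb{N}},d)=a.$$ In particular, by choosing suitable $a$ and $b$, one obtains a $\mathbb{Z}$-action for which all of these four quantities are pairwise distinct for every $\varepsilon\in(0,1)$.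
   Context: A $\mathbb{Z}$-action $(X,\mathbb{Z})$ is a nonempty compact metrizable space $X$ with the action of $\mathbb{Z}$ generated by a homeomorphism $T:X\to X$; $d$ is a metric compatible with the topology. For the sequence $F_n=\{0,1,\dots,n-1\}$ put $d_{F_n}(x,y)=\max_{0\le k<n}d(T^kx,T^ky)$. For nonempty $K\subset X$ and $\delta>0$, $s_{F_n}(K,\delta,d)$ is the maximal cardinality of a set $H\subset K$ with $d_{F_n}(x,y)>\delta$ for all distinct $x,y\in H$, and $$h_{\mathrm{top}}(K,\delta,\{F_n\}_{n\in\mathbb N},d)=\limsup_{n\to\infty}\frac1{|F_n|}\log s_{F_n}(K,\delta,d).$$ For $\varepsilon>0$ and $x\in X$, $$\Gamma_\varepsilon^{\{F_n\}_{n\in\mathbb N}}(x)=\bigcap_{n\in\mathbb N}\{y\in X: d(T^kx,T^ky)\le\varepsilon\ \text{for all } k\in F_n\}.$$ Write $q(x,\delta)=\dfrac{h_{\mathrm{top}}(\Gamma_{\varepsilon}^{\{F_n\}_{n\in\mathbb{N}}}(x),\delta,\{F_n\}_{n\in\mathbb N},d)}{\log \frac{1}{\delta}}$. Then $$\overline{D}_{\mathrm{int}}(X,\varepsilon,\{F_n\},d)=\limsup_{\delta\to0}\sup_{x\in X}q(x,\delta),\quad \underline{D}_{\mathrm{int}}(X,\varepsilon,\{F_n\},d)=\liminf_{\delta\to0}\sup_{x\in X}q(x,\delta),$$ $$\overline{D}_{\mathrm{ext}}(X,\varepsilon,\{F_n\},d)=\sup_{x\in X}\limsup_{\delta\to0}q(x,\delta),\quad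 \underline{D}_{\mathrm{ext}}(X,\varepsilon,\{F_n\},d)=\sup_{x\in X}\liminf_{\delta\to0}q(x,\delta).$$ *)

(* Defs.v *)
From HB Require Import structures.
From mathcomp Require Import all_boot all_order all_algebra.
From mathcomp Require Import all_classical all_reals all_analysis.

Set Implicit Arguments.
Unset Strict Implicit.
Unset Printing Implicit Defensive.

Import Order.TTheory GRing.Theory Num.Theory.
Import numFieldNormedType.Exports.

Local Open Scope classical_set_scope.
Local Open Scope ring_scope.

Definition homeomorphism (X : topologicalType) (T : X -> X) : Prop :=
  continuous T /\ exists2 S : X -> X, continuous S & cancel T S /\ cancel S T.

(* A metricType carries the topology induced by its distance mdist, so X is at
   once a metrizable space and a chosen compatible metric d := mdist. *)
Definition is_Zaction (R : realType) (X : metricType R) (T : X -> X) : Prop :=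
  [/\ [set: X] !=set0, compact [set: X] & homeomorphism T].

Section entropy.
Context {R : realType} {X : metricType R} (T : X -> X).
Implicit Types (K H : set X) (delta eps : R) (n : nat) (x y : X).

Definition dF n x y : R :=
  \big[Num.max/0]_(k < n) mdist (iter k T x) (iter k T y).

Definition separated n delta H : Prop :=
  forall x y, H x -> H y -> x <> y -> delta < dF n x y.

(* counting H is +oo for infinite H; if X is compact, T is continuous and
   0 < delta, the supremum is a maximum and is finite. *)
Definition s_sep n K delta : \bar R :=
  ereal_sup [set counting H | H in [set H | H `<=` K /\ separated n delta H]].

Definition h_top K delta : \bar R :=
  limn_esup (fun n => (n%:R^-1)%:E * lne (s_sep n K delta))%E.

Definition Gamma eps x : set X :=
  \bigcap_n [set y | forall k, (k < n)%N ->
                       mdist (iter k T x) (iter k T y) <= eps].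

Definition q_ratio eps x delta : \bar R :=
  (h_top (Gamma eps x) delta * ((ln (1 / delta))^-1)%:E)%E.

Definition D_int_upper eps : \bar R :=
  limf_esup (fun delta => ereal_sup [set q_ratio eps x delta | x in [set: X]])
            0^'+.

Definition D_int_lower eps : \bar R :=
  limf_einf (fun delta => ereal_sup [set q_ratio eps x delta | x in [set: X]])
            0^'+.

Definition D_ext_upper eps : \bar R :=
  ereal_sup [set limf_esup (q_ratio eps x) 0^'+ | x in [set: X]].

Definition D_ext_lower eps : \bar R :=
  ereal_sup [set limf_einf (q_ratio eps x) 0^'+ | x in [set: X]].

End entropy.

(* Main.v *)
Require Import Defs.
From HB Require Import structures.
From mathcomp Require Import all_boot all_order all_algebra.
From mathcomp Require Import all_classical all_reals all_analysis.
From mathcomp Require Import finmap zify ring lra.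

Set Implicit Arguments.
Unset Strict Implicit.
Unset Printing Implicit Defensive.

Import Order.TTheory GRing.Theory Num.Theory.
Import numFieldNormedType.Exports.

Local Open Scope classical_set_scope.
Local Open Scope ring_scope.

(* X consists of sequences x : Z -> N -> N acted on by the shift in the first
   variable, with distance 2^-m where m is the least |n| + j such that
   x n j <> y n j. The layer x _ 0 marks a coset of kZ, at most one integer,
   or nothing; the other layers vanish unless the markers have a finite gap k,
   in which case x n j is a free digit below 2 ^ (digits k j).

   For eps < 1, points of Gamma_eps(x) share the markers of x at nonnegative
   times, hence the gap k of x, so at scale 2^-w the entropy of Gamma_eps(x) is
   at most (\sum_(j < w) digits k j) * ln 2, with equality for the point with
   markers kZ and zero digits once 2^-k <= eps. Digits of gap k live on levels
   j >= k: on level j there are F (j + 1) - F j of them, plus one if j < k^2,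
   where F w / w oscillates between a and b. For fixed k the sum is F w + O(1),
   which gives the two D_ext; with k of order w / M and M large it is
   F w + w - O(w / M), which gives the two D_int. *)

(** * Agreement of arrays on windows and the resulting ultrametric *)

Definition agree (w : nat) (x y : int -> nat -> nat) : Prop :=
  forall (n : int) (j : nat), (`|n| + j < w)%N -> x n j = y n j.

Lemma agree_le (v w : nat) x y : (v <= w)%N -> agree w x y -> agree v x y.
Proof. by move=> vw xy n j nj; apply: xy; exact: leq_trans nj vw. Qed.

Lemma agreeC (w : nat) x y : agree w x y -> agree w y x.
Proof. by move=> xy n j /xy. Qed.

Lemma agree_trans (w : nat) y x z : agree w x y -> agree w y z -> agree w x z.
Proof. by move=> xy yz n j nj; rewrite xy// yz. Qed.

Lemma agreeP x y : (forall w, agree w x y) -> x = y.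
Proof.
move=> xy; apply/funext => n; apply/funext => j.
by apply: (xy (`|n| + j).+1); rewrite ltnS.
Qed.

Section sequence_distance.
Context {R : realType}.
Implicit Types x y z : int -> nat -> nat.

Lemma ler_2VX (m n : nat) : ((2 ^- m : R) <= 2 ^- n) = (n <= m)%N.
Proof. by rewrite lef_pV2 ?posrE ?exprn_gt0// ler_eXn2l// ltr1n. Qed.

Lemma exists_lt_2VX (e : R) : 0 < e -> exists w, 2 ^- w < e.
Proof.
move=> e0; exists (Num.truncn e^-1).+1.
rewrite invf_plt ?posrE ?exprn_gt0//; apply: lt_trans (truncnS_gt _) _.
by rewrite -natrX ltr_nat ltn_expl.
Qed.

(** [agree m.+1] tests the coordinates with [|n| + j <= m], so the least [m] at which it fails is
    the least [|n| + j] of a disagreement. *)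
Definition seq_dist x y : R :=
  if pselect (exists m, `[< ~ agree m.+1 x y >]) is left h
  then 2 ^- ex_minn h else 0.

Lemma seq_dist_le (w : nat) x y : seq_dist x y <= 2 ^- w <-> agree w x y.
Proof.
rewrite /seq_dist; case: pselect => [h|h]; last first.
  split=> _; last by rewrite invr_ge0 exprn_ge0.
  apply: contrapT => nxy; apply: h; exists w; apply/asboolP => xy.
  exact/nxy/(agree_le _ xy).
case: ex_minnP => m /asboolP nxy mmin; rewrite ler_2VX; split=> [wm|xy].
  apply: contrapT => nw; case: w wm nw => [_|w wm nw].
    by apply => n j.
  have : `[< ~ agree w.+1 x y >] by exact/asboolP.
  by move=> /mmin; lia.
by rewrite leqNgt; apply/negP => mw; apply: nxy; exact: agree_le xy.
Qed.

Lemma seq_dist_ge0 x y : 0 <= seq_dist x y.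
Proof.
by rewrite /seq_dist; case: pselect => // h; rewrite invr_ge0 exprn_ge0.
Qed.

Lemma seq_dist_lt (w : nat) x y : seq_dist x y < 2 ^- w <-> agree w.+1 x y.
Proof.
split=> [|/seq_dist_le d]; last first.
  by apply: le_lt_trans d _; rewrite ltNge ler_2VX ltnn.
rewrite /seq_dist; case: pselect => [h|h d].
  case: ex_minnP => m /asboolP nxy mmin; rewrite ltNge ler_2VX -ltnNge => wm.
  apply: contrapT => nw.
  have : `[< ~ agree w.+1 x y >] by exact/asboolP.
  by move=> /mmin; lia.
by apply: contrapT => nxy; apply: h; exists w; exact/asboolP.
Qed.

Lemma seq_dist_eq0 x y : seq_dist x y = 0 -> x = y.
Proof.
move=> xy; apply: agreeP => w; apply/seq_dist_le.
by rewrite xy invr_ge0 exprn_ge0.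
Qed.

Lemma seq_distxx x : seq_dist x x = 0.
Proof. by rewrite /seq_dist; case: pselect => // -[m /asboolP[]]. Qed.

Lemma seq_distC x y : seq_dist x y = seq_dist y x.
Proof.
wlog suff : x y / seq_dist x y <= seq_dist y x.
  by move=> le_xy; apply/eqP; rewrite eq_le !le_xy.
rewrite {2}/seq_dist; case: pselect => [h|h].
  case: ex_minnP => m /asboolP nxy mmin; apply/seq_dist_le/agreeC.
  apply: contrapT => nyx; case: m nxy mmin nyx => [_ _ |m nxy mmin nyx].
    by apply.
  have : `[< ~ agree m.+1 y x >] by exact/asboolP.
  by move=> /mmin; lia.
suff -> : x = y by rewrite seq_distxx.
apply: agreeP => w; apply: contrapT => nxy; apply: h; exists w.
by apply/asboolP => yx; apply/nxy/agreeC/(agree_le _ yx).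
Qed.

Lemma seq_dist_ultra y x z (r : R) :
  seq_dist x y <= r -> seq_dist y z <= r -> seq_dist x z <= r.
Proof.
have [r0|r0] := leP r 0.
  move=> xy yz; have {}xy : x = y.
    by apply: seq_dist_eq0; apply/eqP; rewrite eq_le seq_dist_ge0 (le_trans xy).
  by rewrite xy.
move=> xy yz.
rewrite /seq_dist; case: pselect => [h|_]; last exact: ltW.
case: ex_minnP => m /asboolP nxz _; rewrite leNgt; apply/negP => rm.
apply: nxz; apply: (@agree_trans _ y); apply/seq_dist_lt.
- exact: le_lt_trans rm.
- exact: le_lt_trans rm.
Qed.

End sequence_distance.

(** * The compact phase space and its shift *)

Definition gap (x : int -> nat -> nat) (k : nat) (i : int) : Prop :=
  [/\ x i 0%N = 1%N, x (i + k%:Z) 0%N = 1%N &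
      forall l, (0 < l < k)%N -> x (i + l%:Z) 0%N <> 1%N].

(* The second condition says that the marked integers are closed under affine
   combinations. Asking in the third one for a gap near n, rather than anywhere,
   makes it depend on finitely many coordinates, so that it passes to limits. *)
Definition admissible (E : nat -> nat -> nat) (x : int -> nat -> nat) : Prop :=
  [/\ forall n, (x n 0 <= 1)%N,
      forall n m p, x n 0%N = 1%N -> x m 0%N = 1%N -> x p 0%N = 1%N ->
        x (n + m - p) 0%N = 1%N &
      forall n j, (0 < j)%N -> x n j <> 0%N -> exists k i,
        [/\ gap x k i, n <= i < n + k%:Z & (x n j < 2 ^ E k j)%N] ].

Definition space (R : realType) (E : nat -> nat -> nat) : Type :=
  {x : int -> nat -> nat | admissible E x}.

Section space_metric.
Context (R : realType) (E : nat -> nat -> nat).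
Local Notation X := (space R E).
Implicit Types x y z : X.

HB.instance Definition _ := gen_eqMixin X.
HB.instance Definition _ := gen_choiceMixin X.

Definition space_dist x y : R := seq_dist (sval x) (sval y).

Lemma space_eq x y : sval x = sval y -> x = y.
Proof.
case: x y => [x hx] [y hy] /= xy; subst y.
by congr exist; exact: Prop_irrelevance.
Qed.

Let space_distxx x : space_dist x x = 0.
Proof. exact: seq_distxx. Qed.

Let space_dist_eq0 x y : space_dist x y = 0 -> x = y.
Proof. by move=> /seq_dist_eq0/space_eq. Qed.

Let space_distC x y : space_dist x y = space_dist y x.
Proof. exact: seq_distC. Qed.

Let space_dist_triangle y x z :
  space_dist x z <= space_dist x y + space_dist y z.
Proof.
by apply: (@seq_dist_ultra _ (sval y)); rewrite ?lerDl ?lerDr seq_dist_ge0.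
Qed.

HB.instance Definition _ := isMetric.Build R X
  space_distxx space_dist_eq0 space_distC space_dist_triangle.

Lemma space_nonempty : [set: X] !=set0.
Proof.
have h : admissible E (fun _ _ => 0%N) by split.
by exists (exist _ _ h).
Qed.

Lemma mdistE x y : mdist x y = seq_dist (sval x) (sval y).
Proof. by []. Qed.

Lemma mdist_agree (w : nat) x y :
  mdist x y <= 2 ^- w <-> agree w (sval x) (sval y).
Proof. exact: seq_dist_le. Qed.

Lemma nbhs_agree x (A : set X) :
  nbhs x A <-> exists w, forall y, agree w (sval x) (sval y) -> A y.
Proof.
rewrite -nbhs_ballE; split=> [[e /= e0 xA]|[w xA]].
  have [w we] := exists_lt_2VX e0.
  exists w => y /mdist_agree xy; apply: xA.
  by rewrite ballEmdist /=; exact: le_lt_trans we.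
exists (2 ^- w); first by rewrite /= invr_gt0 exprn_gt0.
move=> y; rewrite ballEmdist /= => /ltW/mdist_agree; exact: xA.
Qed.

Hypothesis E_supp : forall k j, (0 < E k j)%N -> (0 < k <= j)%N.

(** A nonzero digit on level [j] comes from a gap [k <= j], so only finitely many alphabets occur
    there; compactness rests on this. *)
Lemma space_bounded j : exists B, forall (n : int) x, (sval x n j < B)%N.
Proof.
exists (\sum_(k < j.+1) 2 ^ E k j).+2%N => n [x [x01 _ xE]] /=.
case: j => [|j]; first by have := x01 n; lia.
have [->//|/eqP xn0] := eqVneq (x n j.+1) 0%N.
have [k [i [_ _ xk]]] := xE _ _ (ltn0Sn j) xn0.
have /E_supp/andP[_ kj] : (0 < E k j.+1)%N.
  by rewrite lt0n; apply/eqP => Ekj; move: xk; rewrite Ekj; lia.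
rewrite (bigD1 (Ordinal (kj : (k < j.+2)%N)))//=; lia.
Qed.

(** Each clause is tested on a finite window. For the last one, a nonzero digit on level [j] has a
    gap [k <= j] starting within [j] of [n], so the whole gap lies within [2j] of [n]. *)
Lemma admissible_closed v :
  (forall w, exists x, agree w (sval x) v) -> admissible E v.
Proof.
move=> xv; split=> [n|n m p vn vm vp|n j j0 vn].
- have [[x /= [x01 _ _]] /(_ n 0%N) <-//] := xv `|n|.+1; lia.
- have [[x /= [_ xD _]] xw] := xv (`|n| + `|m| + `|p|).+1.
  rewrite -xw; first by apply: xD; rewrite xw//; lia.
  lia.
- have [[x /= [_ _ xE]] xw] := xv (`|n| + (j + j + j)).+1.
  have vxn : v n j = x n j by rewrite xw//; lia.
  have [|k [i [[xi xik xl] nik xk]]] := xE n j j0; first by rewrite -vxn.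
  have /E_supp/andP[k0 kj] : (0 < E k j)%N.
    by rewrite lt0n; apply/eqP => Ekj; move: xk; rewrite Ekj; lia.
  exists k, i; split => //; last by rewrite vxn.
  split; [by rewrite -xw//; lia|by rewrite -xw//; lia|move=> l lk].
  by rewrite -xw; [exact: xl|lia].
Qed.

(** Every coordinate takes finitely many values, so an ultrafilter fixes each of them, and the array
    of these values is its limit. *)
Lemma space_compact : compact [set: X].
Proof.
rewrite compact_ultra => F UF _.
have PF : ProperFilter F by exact: ultra_proper.
have Fv n j : exists v, F [set x | sval x n j = v].
  have [B xB] := space_bounded j.
  have : F [set x | (sval x n j < B)%N].
    by apply: filterS filterT => x _; exact: xB.
  elim: B {xB} => [|B IH FB].
    by move=> F0; have [] := filter_not_empty F; apply: filterS F0.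
  have [?|FBC] := in_ultra_setVsetC [set x | sval x n j = B] UF.
    by exists B.
  apply: IH; apply: filterS (filterI FB FBC) => x [/= xB nxB]; lia.
pose v n j := projT1 (cid (Fv n j)).
have FvE n j : F [set x | sval x n j = v n j] by rewrite /v; case: cid.
have Fw w : F [set x | agree w (sval x) v].
  have : F [set x : X | forall i : 'I_(w + w) * 'I_w,
      sval x (i.1%:Z - w%:Z) i.2 = v (i.1%:Z - w%:Z) i.2].
    by apply: filter_forall => i; exact: FvE.
  apply: filterS => x /= xv n j nj.
  have nw : (`|(n + w%:Z)%R| < w + w)%N by lia.
  have jw : (j < w)%N by lia.
  have := xv (Ordinal nw, Ordinal jw) => /=.
  by rewrite (_ : `|(n + w%:Z)%R|%N%:Z - w%:Z = n)//; lia.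
have av : admissible E v.
  by apply: admissible_closed => w; have [x xw] := filter_ex (Fw w); exists x.
exists (exist _ v av); split => // A /nbhs_agree[w wA].
by apply: filterS (Fw w) => x /agreeC; exact: wA.
Qed.

Lemma shift_admissible (m : int) x :
  admissible E (fun n => sval x (n + m)).
Proof.
case: x => x [x01 xD xE] /=; split=> [n|n p q xn xp xq|n j j0 xn].
- exact: x01.
- rewrite (_ : n + p - q + m = (n + m) + (p + m) - (q + m)); last by ring.
  exact: xD.
- have [k [i [[xi xik xl] nik xk]]] := xE _ _ j0 xn.
  exists k, (i - m); split => //; last by lia.
  split=> [||l /xl]; first by rewrite subrK.
    by rewrite addrAC subrK.
  by rewrite addrAC subrK.
Qed.

Definition shift (m : int) x : X := exist _ _ (shift_admissible m x).

Lemma shiftE m x : sval (shift m x) = fun n => sval x (n + m).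
Proof. by []. Qed.

Lemma shiftK m : cancel (shift m) (shift (- m)).
Proof.
move=> x; apply: space_eq; rewrite !shiftE.
by apply/funext => n; rewrite subrK.
Qed.

Lemma shift_continuous m : continuous (shift m).
Proof.
move=> x A /nbhs_agree[w wA]; apply/nbhs_agree.
exists (w + `|m|)%N => y xy; apply: wA => n j nj; apply: xy => /=; lia.
Qed.

Lemma shift_homeo m : homeomorphism (shift m).
Proof.
split; first exact: shift_continuous.
exists (shift (- m)); first exact: shift_continuous.
by split; [exact: shiftK|rewrite -{2}(opprK m); exact: shiftK].
Qed.

Lemma iter_shift1 k x : iter k (shift 1) x = shift k%:Z x.
Proof.
elim: k => [|k IH].
  by apply: space_eq; rewrite shiftE; apply/funext => n; rewrite addr0.
apply: space_eq; rewrite iterS IH !shiftE; apply/funext => n.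
by rewrite -addrA -intS.
Qed.

Lemma mdist_iter k (w : nat) x y :
  mdist (iter k (shift 1) x) (iter k (shift 1) y) <= 2 ^- w <->
  forall n j, (`|n| + j < w)%N -> sval x (n + k%:Z) j = sval y (n + k%:Z) j.
Proof.
by rewrite !iter_shift1; split => [/mdist_agree|xy]; [|apply/mdist_agree].
Qed.

End space_metric.

(** * Cardinality bounds and blocks of digits *)

Section counting.
Context (R : realType).

Lemma counting_le_card (T : choiceType) (U : finType) (g : T -> U) (H : set T) :
  {in H &, injective g} -> (@counting T R H <= #|U|%:R%:E)%E.
Proof.
move=> g_inj; have gH := inj_card_eq g_inj.
have fH : finite_set H.
  by rewrite -(eq_finite_set gH); exact: finite_finset.
rewrite /counting asboolT// lee_fin ler_nat.
have sz : uniq [seq g x | x <- enum_fset (fset_set H)].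
  rewrite map_inj_in_uniq ?fset_uniq// => x y.
  by rewrite !in_fset_set//; exact: g_inj.
have := max_card (mem [seq g x | x <- enum_fset (fset_set H)]).
by rewrite (card_uniqP sz) size_map.
Qed.

Lemma counting_image_ge (T : choiceType) (U : finType) (f : U -> T) :
  injective f -> (#|U|%:R%:E <= @counting T R (f @` [set: U]))%E.
Proof.
move=> f_inj; have fH : finite_set (f @` [set: U]).
  by apply: finite_image; exact: finite_finset.
rewrite /counting asboolT// lee_fin ler_nat.
have sz : uniq [seq f u | u <- enum U] by rewrite map_inj_uniq ?enum_uniq.
rewrite cardT -(size_map f); apply: uniq_leq_size => // x /mapP[u _ ->].
by rewrite in_fset_set//; apply/mem_set; exists u.
Qed.

End counting.

(* (2 ^ e).-1.+1 is 2 ^ e, in the shape required by inord. *)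
Definition block (E : nat -> nat -> nat) (k w n : nat) : finType :=
  {dffun forall j : 'I_w, {ffun 'I_n -> 'I_(2 ^ E k j).-1.+1}}.

Lemma card_block E k w n :
  #|block E k w n| = (2 ^ (n * \sum_(j < w) E k j))%N.
Proof.
rewrite card_dep_ffun foldrE big_image/= mulnC big_distrl/= expn_sum.
apply: eq_bigr => j _; rewrite card_ffun !card_ord prednK ?expn_gt0//.
by rewrite -expnM.
Qed.

(** * Gaps of markers and what an orbit tube determines *)

Section orbit_tubes.
Context (R : realType) (E : nat -> nat -> nat).
Hypothesis E_supp : forall k j, (0 < E k j)%N -> (0 < k <= j)%N.
Local Notation X := (space R E).
Implicit Types x y : X.

(** Forward, the combination [(i + p k) + (i + k) - i] adds one step; backward markers are the
    reflections [i + i - (i + p k)] of forward ones. *)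
Lemma marker_progression x k i (m : int) : gap (sval x) k i ->
  sval x (i + m * k%:Z) 0%N = 1%N.
Proof.
case: x => x [x01 xD xE] /= [xi xik _].
have pos (p : nat) : x (i + p%:Z * k%:Z) 0%N = 1%N.
  elim: p => [|p IH]; first by rewrite mul0r addr0.
  by rewrite (_ : _ + _ = (i + p%:Z * k%:Z) + (i + k%:Z) - i); [exact: xD|ring].
case: m => p; first exact: pos.
by rewrite (_ : _ + _ = i + i - (i + p.+1%:Z * k%:Z));
  [exact: xD|rewrite NegzE; ring].
Qed.

(** A marker inside the translated gap would be carried by an affine combination into the original
    gap. *)
Lemma gap_translate x k i (m : int) : gap (sval x) k i ->
  gap (sval x) k (i + m * k%:Z).
Proof.
move=> g; have xm m' := marker_progression m' g; split; first exact: xm.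
  by rewrite (_ : _ + _ = i + (m + 1) * k%:Z); [exact: xm|ring].
move=> l lk xl; case: g (xm m) => xi _ /(_ l lk) nxl xim; apply: nxl.
case: x xi xl xim {xm} => x [/= _ xD _] xi xl xim.
rewrite (_ : i + l%:Z = (i + m * k%:Z + l%:Z) + i - (i + m * k%:Z)).
  exact: xD.
by ring.
Qed.

Lemma gap_unique x k i k' i' : (0 < k)%N -> (0 < k')%N ->
  gap (sval x) k i -> gap (sval x) k' i' -> k = k'.
Proof.
wlog kk' : k i k' i' / (k < k')%N.
  move=> H k0 k0' g g'; case: (ltngtP k k') => // kk'.
    exact: (H k i k' i').
  exact/esym/(H k' i' k i).
move=> k0 k'0 g [_ _ g'].
(* A progression of step [k] meets every half-open interval of length [k]; as [k < k'], the point
   found is strictly inside the gap of length [k']. *)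
have [m im] : exists m : int, i' < i + m * k%:Z <= i' + k%:Z.
  exists (((i' - i) %/ k%:Z)%Z + 1).
  have k0' : (k%:Z != 0) by lia.
  have := divz_eq (i' - i) k%:Z; have := ltz_mod (i' - i) k0'.
  have := modz_ge0 (i' - i) k0'; set q := (_ %/ _)%Z; set r := (_ %% _)%Z.
  by rewrite mulrDl mul1r; lia.
have [l lE] : exists l : nat, i + m * k%:Z = i' + l%:Z.
  by exists `|(i + m * k%:Z - i')%R|%N; lia.
have := marker_progression m g; rewrite lE => /g'[]; lia.
Qed.

Lemma gapped_digit x n j : (0 < j)%N -> sval x n j <> 0%N ->
  exists k i, [/\ (0 < k)%N, gap (sval x) k i & (sval x n j < 2 ^ E k j)%N].
Proof.
case: x => x [_ _ xE] j0 /= xn; have [k [i [g _ xk]]] := xE n j j0 xn.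
exists k, i; split=> //.
have /E_supp/andP[//] : (0 < E k j)%N.
by rewrite lt0n; apply/eqP => Ekj; move: xk; rewrite Ekj; lia.
Qed.

Variables (eps : R) (eps_lt1 : eps < 1).

(** Since [eps < 1 = 2 ^- 0], closeness at time [n] forces the shifted points to agree at the
    coordinate [(0, 0)], which is the marker at [n]. *)
Lemma Gamma_markers x y (n : nat) : Gamma (shift 1) eps x y ->
  sval y n%:Z 0%N = sval x n%:Z 0%N.
Proof.
move=> /(_ n.+1 I n (ltnSn n)) xy.
have : mdist (iter n (shift 1) x) (iter n (shift 1) y) < 2 ^- 0.
  by rewrite expr0 invr1; exact: le_lt_trans xy eps_lt1.
rewrite !iter_shift1 mdistE => /seq_dist_lt/(_ 0 0%N) /=.
by rewrite !add0r => ->.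
Qed.

(** Here [k] is the gap of [x]. A gap of [y] can be translated to nonnegative times, where [y] has
    the markers of [x], so it has the same length. *)
Lemma Gamma_digits x : exists k, forall y, Gamma (shift 1) eps x y ->
  forall n j, (0 < j)%N -> (sval y n j < 2 ^ E k j)%N.
Proof.
have transfer y k i : Gamma (shift 1) eps x y -> (0 < k)%N ->
    gap (sval y) k i -> exists i', gap (sval x) k i'.
  move=> xy k0 g; have := gap_translate `|i|%N%:Z g.
  have : 0 <= i + `|i|%N%:Z * k%:Z by nia.
  case: (i + _ * _) => // i' _ [y1 y2 y3]; exists i'%:Z.
  split; first by rewrite -(Gamma_markers _ xy).
    by rewrite -PoszD -(Gamma_markers _ xy).
  by move=> l lk; rewrite -PoszD -(Gamma_markers _ xy) PoszD; exact: y3.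
have [[k [i [k0 g]]]|nog] :=
    pselect (exists k i, (0 < k)%N /\ gap (sval x) k i).
  exists k => y xy n j j0.
  have [->|/eqP yn] := eqVneq (sval y n j) 0%N; first by rewrite expn_gt0.
  have [k' [i' [k'0 g' yk']]] := gapped_digit j0 yn.
  have [i'' g''] := transfer _ _ _ xy k'0 g'.
  by rewrite (gap_unique k0 k'0 g g'').
(* If [x] has no gap, the points of the tube have no nonzero digit, and any [k] would serve. *)
exists 0%N => y xy n j j0.
have [->|/eqP yn] := eqVneq (sval y n j) 0%N; first by rewrite expn_gt0.
have [k' [i' [k'0 g' yk']]] := gapped_digit j0 yn.
have [i'' g''] := transfer _ _ _ xy k'0 g'.
by exfalso; apply: nog; exists k', i''.
Qed.

End orbit_tubes.

(** * Exponential bounds for separated sets in a tube *)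

Section separated_orbits.
Context (R : realType) (E : nat -> nat -> nat).
Hypothesis E_supp : forall k j, (0 < E k j)%N -> (0 < k <= j)%N.
Local Notation X := (space R E).
Local Notation T := (@shift R E 1).
Implicit Types x y : X.

Lemma dF_shift_le n (w : nat) x y :
  (forall m j, - w%:Z < m < n%:Z + w%:Z -> (j < w)%N ->
    sval x m j = sval y m j) ->
  dF T n x y <= 2 ^- w.
Proof.
move=> xy; apply: bigmax_le => [|k _]; first by rewrite invr_ge0 exprn_ge0.
apply/mdist_iter => m j mj; have := ltn_ord k => kn; apply: xy; lia.
Qed.

Lemma dF_shift_ge n (w : nat) x y (m j : nat) :
  (m < n)%N -> (j <= w)%N -> sval x m%:Z j <> sval y m%:Z j ->
  2 ^- w <= dF T n x y.
Proof.
move=> mn jw xy.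
apply: (@le_trans _ _ (mdist (iter m T x) (iter m T y))); last first.
  by rewrite /dF; exact: (le_bigmax _ (fun k : 'I_n => _) (Ordinal mn)).
rewrite leNgt mdistE !iter_shift1; apply/negP => /seq_dist_lt/(_ 0 j).
by rewrite !shiftE add0r add0n ltnS => /(_ jw).
Qed.

(** Up to [delta], a point of the tube is coded by its digits on levels below [w] at times from [-w]
    to [n + w - 1] and by its markers at [w] negative times; the other markers are those of [x]. So
    the number of marker bits does not grow with [n]. *)
Lemma s_sep_Gamma_le (eps : R) x : eps < 1 ->
  exists k, forall (w n : nat) (delta : R), 2 ^- w <= delta ->
  (s_sep T n (Gamma T eps x) delta <=
     (2 ^ (w + (n + (w + w)) * \sum_(j < w) E k j))%:R%:E)%E.
Proof.
move=> eps_lt1; have [k kP] := Gamma_digits E_supp eps_lt1 x.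
exists k => w n delta wd.
apply: ge_ereal_sup => _ [H [HG sepH] <-].
pose code y : {ffun 'I_w -> bool} * block E k w (n + (w + w)) :=
  ([ffun i : 'I_w => sval y (i%:Z - w%:Z) 0%N == 1%N],
   [ffun j : 'I_w => [ffun m : 'I_(n + (w + w)) =>
     inord (sval y (m%:Z - w%:Z) j)]]).
apply: le_trans (counting_le_card R (g := code) _) _; last first.
  by rewrite card_prod card_ffun card_bool card_ord card_block -expnD.
move=> y z /set_mem Hy /set_mem Hz [/ffunP yz0 /ffunP yz].
apply: contrapT => /(sepH _ _ Hy Hz); apply/negP; rewrite -leNgt.
apply: le_trans wd; apply: dF_shift_le => m j mn jw.
have [j0|j0] := posnP j; last first.
  have mP : (`|(m + w%:Z)%R| < n + (w + w))%N by lia.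
  have mE : `|(m + w%:Z)%R|%N%:Z - w%:Z = m by lia.
  have := yz (Ordinal jw); rewrite !ffunE => /ffunP/(_ (Ordinal mP)).
  rewrite !ffunE /= mE => /(congr1 (@nat_of_ord _)).
  (* Digits of tube points lie below [2 ^ E k j], so [inord] loses nothing. *)
  by rewrite !inordK ?prednK ?expn_gt0//; apply: kP => //; exact: HG.
rewrite j0 {j j0 jw}; case: (lerP 0 m) mn => m0 mn.
  case: m m0 {mn} => // m _.
  have /= -> := Gamma_markers eps_lt1 m (HG _ Hy).
  by have /= -> := Gamma_markers eps_lt1 m (HG _ Hz).
have mP : (`|(m + w%:Z)%R| < w)%N by lia.
have mE : `|(m + w%:Z)%R|%N%:Z - w%:Z = m by lia.
have := yz0 (Ordinal mP); rewrite !ffunE /= mE.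
have [y01 _ _] := svalP y; have [z01 _ _] := svalP z.
have := y01 m; have := z01 m; lia.
Qed.

Variable eps : R.

Definition periodic_seq (k : nat) (z : int -> nat -> nat) : int -> nat -> nat :=
  fun n j => if j == 0%N then nat_of_bool (k%:Z %| n)%Z else z n j.

Lemma periodic_admissible k z : (0 < k)%N ->
  (forall n j, (0 < j)%N -> (z n j < 2 ^ E k j)%N) ->
  admissible E (periodic_seq k z).
Proof.
move=> k0 zE; have marked n : (periodic_seq k z n 0 = 1)%N <-> (k%:Z %| n)%Z.
  by rewrite /periodic_seq /=; case: (_ %| _)%Z.
split=> [n|n m p /marked kn /marked km /marked kp|n j j0 _].
- by rewrite /periodic_seq /=; case: (_ %| _)%Z.
- by apply/marked; rewrite rpredB ?rpredD.
(* The least multiple of [k] that is at least [n]. *)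
- exists k, (- (- n %/ k%:Z)%Z * k%:Z); split.
  + split; first by apply/marked; rewrite dvdz_mull.
      by apply/marked; rewrite rpredD ?dvdz_mull.
    move=> l lk /marked; rewrite rpredDl ?dvdz_mull//.
    by rewrite /dvdz /= => /dvdn_leq; lia.
  + have k0' : (k%:Z != 0) by lia.
    have := divz_eq (- n) k%:Z; have := ltz_mod (- n) k0'.
    have := modz_ge0 (- n) k0'; set q := (_ %/ _)%Z; set r := (_ %% _)%Z.
    by rewrite mulNr; lia.
  + by rewrite /periodic_seq gtn_eqF// zE.
Qed.

Definition periodic_point k z (k0 : (0 < k)%N)
  (zE : forall n j, (0 < j)%N -> (z n j < 2 ^ E k j)%N) : X :=
  exist _ _ (periodic_admissible k0 zE).

(** A window of radius [k] shows only levels below [k], where [E k j = 0] leaves no digit; the two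
    points show nothing there but their common markers. *)
Lemma periodic_Gamma k z z' k0 (zE : forall n j, _) (z'E : forall n j, _) :
  2 ^- k <= eps ->
  Gamma T eps (@periodic_point k z k0 zE) (@periodic_point k z' k0 z'E).
Proof.
move=> keps n _ m _; apply: le_trans keps; apply/mdist_iter => i j ij /=.
rewrite /periodic_seq; case: eqP => // /eqP j0.
have E0 : E k j = 0%N.
  apply/eqP; rewrite -leqn0 leqNgt; apply/negP => /E_supp; lia.
have j1 : (0 < j)%N by rewrite lt0n.
have := zE (i + m%:Z) j j1; have := z'E (i + m%:Z) j j1.
by rewrite E0 expn0; lia.
Qed.

(** Digits at times [0] to [n - 1] on levels up to [w] can be chosen freely; two choices differing
    at time [m] are at distance at least [2 ^- w] at that time. *)
Lemma s_sep_Gamma_ge k : (0 < k)%N -> 2 ^- k <= eps ->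
  exists x, forall (w n : nat) (delta : R), delta < 2 ^- w ->
  ((2 ^ (n * \sum_(j < w.+1) E k j))%:R%:E <=
     s_sep T n (Gamma T eps x) delta)%E.
Proof.
move=> k0 keps.
have zE0 (n : int) j : (0 < j)%N -> (0 < 2 ^ E k j)%N.
  by rewrite expn_gt0.
exists (@periodic_point k (fun _ _ => 0%N) k0 zE0) => w n delta dw.
pose z (u : block E k w.+1 n) (i : int) (j : nat) : nat :=
  if i is Posz m then
    if insub j is Some j' then
      if insub m is Some m' then nat_of_ord (u j' m') else 0%N
    else 0%N
  else 0%N.
have zE u i j : (0 < j)%N -> (z u i j < 2 ^ E k j)%N.
  move=> _; rewrite /z; case: i => [m|m]; last by rewrite expn_gt0.
  case: insubP => [j' _ jj'|_]; last by rewrite expn_gt0.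
  case: insubP => [m' _ _|_]; last by rewrite expn_gt0.
  by rewrite -jj' -[ltnRHS]prednK ?expn_gt0.
pose f u : X := periodic_point k0 (zE u).
have f_sep u v : u <> v -> 2 ^- w <= dF T n (f u) (f v).
  move=> uv.
  have [j [m uvjm]] : exists j m, u j m <> v j m.
    apply: contrapT => nuv; apply: uv; apply/ffunP => j; apply/ffunP => m.
    by apply: contrapT => uvjm; apply: nuv; exists j, m.
  apply: (@dF_shift_ge _ _ _ _ m j (ltn_ord m)); first by rewrite -ltnS.
  rewrite /f /= /periodic_seq; case: eqP => [j0|_].
    (* Level 0 carries the marker instead of a digit; as [E k 0 = 0], a block has a single letter
       there. *)
    have E0 : ((2 ^ E k j).-1 = 0)%N.
      suff -> : E k j = 0%N by [].
      by apply/eqP; rewrite -leqn0 leqNgt; apply/negP => /E_supp; lia.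
    have o0 (a : 'I_(2 ^ E k j).-1.+1) : a = 0%N :> nat.
      by have := ltn_ord a; rewrite ltnS [X in (_ <= X)%N]E0 leqn0 => /eqP.
    by exfalso; apply: uvjm; apply: val_inj; rewrite /= !o0.
  by rewrite /z !valK => /val_inj.
have f_inj : injective f.
  move=> u v fuv; apply: contrapT => /f_sep; apply/negP; rewrite -ltNge fuv.
  have := @dF_shift_le n w.+1 (f v) (f v) => /(_ (fun _ _ _ _ => erefl)).
  by move=> d; apply: le_lt_trans d _; rewrite ltNge ler_2VX; lia.
rewrite -card_block; apply: le_trans (counting_image_ge R f_inj) _.
apply: ereal_sup_ubound; exists (f @` [set: _]) => //; split.
  by move=> _ [u _ <-]; exact: periodic_Gamma.
move=> _ _ [u _ <-] [v _ <-] fuv; apply: lt_le_trans dw _.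
by apply: f_sep => uv; apply: fuv; rewrite uv.
Qed.

End separated_orbits.

(** * Upper and lower limits through real bounds *)

Section limf_characterization.
Context {R : realType} {U : choiceType} {V : filteredType U}.
Implicit Types (f : V -> \bar R) (F : set (set V)) (l : R).

Lemma limf_esup_le f F l :
  (forall eta : R, 0 < eta -> F [set x | f x <= (l + eta)%:E]%E) ->
  (limf_esup f F <= l%:E)%E.
Proof.
move=> H; apply/lee_addgt0Pr => e e0.
apply: le_trans (ereal_inf_lbound _) _.
  by exists [set x | f x <= (l + e)%:E]%E; [exact: H|].
by apply: ge_ereal_sup => _ [x /= fx <-].
Qed.

Lemma limf_esup_ge f F l :
  (forall A (eta : R), F A -> 0 < eta ->
    exists2 x, A x & ((l - eta)%:E <= f x)%E) ->
  (l%:E <= limf_esup f F)%E.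
Proof.
move=> H; apply: le_ereal_inf_tmp => _ [A FA <-].
apply/lee_subgt0Pr => e e0; have [x Ax fx] := H A e FA e0.
by apply: le_trans fx _; apply: ereal_sup_ubound; exists x.
Qed.

Lemma limf_einf_ge f F l :
  (forall eta : R, 0 < eta -> F [set x | (l - eta)%:E <= f x]%E) ->
  (l%:E <= limf_einf f F)%E.
Proof.
move=> H; rewrite leeNr; apply: limf_esup_le => e /H.
by rewrite (_ : [set x | _ <= f x]%E = [set x | - f x <= (- l + e)%:E]%E)//;
  apply/seteqP; split => x /=; rewrite leeNl -EFinN opprD opprK.
Qed.

Lemma limf_einf_le f F l :
  (forall A (eta : R), F A -> 0 < eta ->
    exists2 x, A x & (f x <= (l + eta)%:E)%E) ->
  (limf_einf f F <= l%:E)%E.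
Proof.
move=> H; rewrite leeNl; apply: limf_esup_ge => A e FA e0.
have [x Ax fx] := H A e FA e0; exists x => //.
by rewrite leeNr -EFinN opprD !opprK.
Qed.

End limf_characterization.

(** * Entropy from exponential growth of separated sets *)

Section entropy_bounds.
Context {R : realType} {X : metricType R} (T : X -> X).
Implicit Types (K : set X) (delta : R) (N c : nat).

Lemma lne_le_ln (s : \bar R) (t : R) :
  0 < t -> (s <= t%:E)%E -> (lne s <= (ln t)%:E)%E.
Proof.
move=> t0 st; rewrite -lne_EFin//; have [s0|s0] := leP s 0%E.
  by rewrite le0_lneNy// leNye.
by rewrite lee_lne// in_itv /= leey ltW ?lte_fin.
Qed.

Lemma ln_le_lne (s : \bar R) (t : R) :
  0 < t -> (t%:E <= s)%E -> ((ln t)%:E <= lne s)%E.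
Proof.
move=> t0 ts; rewrite -lne_EFin// lee_lne// in_itv /= leey andbT
  ?lee_fin ?ltW//.
by apply: lt_le_trans ts; rewrite lte_fin.
Qed.

Lemma h_top_le K delta N c :
  (forall n, (s_sep T n K delta <= (2 ^ (c + n * N))%:R%:E)%E) ->
  (h_top T K delta <= (N%:R * ln 2)%:E)%E.
Proof.
move=> sN; apply: limf_esup_le => eta eta0.
have ln2 : 0 < ln (2 : R) by rewrite ln_gt0// ltr1n.
exists (Num.truncn (c%:R * ln 2 / eta)).+1 => // n /= cn.
have {}cn : c%:R * ln 2 / eta < n%:R.
  by apply: lt_le_trans (truncnS_gt _) _; rewrite ler_nat.
have n0 : 0 < n%:R :> R.
  by apply: le_lt_trans cn; rewrite divr_ge0 ?mulr_ge0 ?ler0n// ltW.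
apply: (@le_trans _ _ ((n%:R^-1)%:E * ((c + n * N)%:R * ln 2)%:E)%E).
  rewrite lee_pmul2l//; last by rewrite lte_fin invr_gt0.
  apply: le_trans (lne_le_ln _ (sN n)) _; first by rewrite ltr0n expn_gt0.
  by rewrite lee_fin natrX lnXn// mulr_natl.
rewrite -EFinM lee_fin natrD natrM -(ler_pM2l n0) mulrA divff ?gt_eqF// mul1r.
rewrite ltr_pdivrMr// in cn; nra.
Qed.

Lemma h_top_ge K delta N :
  (forall n, ((2 ^ (n * N))%:R%:E <= s_sep T n K delta)%E) ->
  ((N%:R * ln 2)%:E <= h_top T K delta)%E.
Proof.
move=> sN; apply: limf_esup_ge => A eta [m _ mA] eta0.
(* The index [m.+1] avoids 0, whose inverse is 0 by convention. *)
exists m.+1; first by apply: mA => /=.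
apply: (@le_trans _ _ (((m.+1)%:R^-1)%:E * ((m.+1 * N)%:R * ln 2)%:E)%E).
  rewrite -EFinM lee_fin natrM -!mulrA mulKf ?pnatr_eq0//.
  by rewrite lerBlDr lerDl ltW.
rewrite lee_pmul2l//.
apply: le_trans (ln_le_lne _ (sN _)); last by rewrite ltr0n expn_gt0.
by rewrite lee_fin natrX lnXn// mulr_natl.
Qed.

End entropy_bounds.

(** * Linear growth rates and limits over dyadic scales *)

Section slopes.
Context {R : realType}.
Implicit Types (G : nat -> R) (alpha beta eta : R) (g : R -> \bar R).

(** This makes [alpha] and [beta] the lower and upper limits of [G w / w], with the overshoot of [G]
    beyond both lines bounded. *)
Definition slopes G alpha beta : Prop :=
  [/\ forall w, 0 <= G w,
      exists C, forall w, alpha * w%:R - C <= G w <= beta * w%:R + C,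
      forall eta w0, 0 < eta ->
        exists2 w, (w0 < w)%N & (beta - eta) * w%:R <= G w &
      forall eta w0, 0 < eta ->
        exists2 w, (w0 < w)%N & G w <= (alpha + eta) * w%:R].

(** Absorbs the bounded number of extra digits that a fixed gap contributes. *)
Lemma slopes_addc G alpha beta (c : nat) : slopes G alpha beta ->
  slopes (fun w => G w + c%:R) alpha beta.
Proof.
move=> [G0 [C GC] Gsup Ginf].
have c0 : 0 <= c%:R :> R by [].
split=> [w||eta w0 eta0|eta w0 eta0].
- by rewrite addr_ge0.
- by exists (C + c%:R) => w; have /andP[] := GC w; lra.
- by have [w w0w] := Gsup eta w0 eta0; exists w => //; lra.
- have e20 : 0 < eta / 2 by rewrite divr_gt0.
  have [w] := Ginf (eta / 2) (maxn w0 (Num.truncn (c%:R / (eta / 2))).+1) e20.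
  rewrite gtn_max => /andP[w0w cw] Gw; exists w => //.
  have : c%:R / (eta / 2) < w%:R.
    by apply: lt_le_trans (truncnS_gt _) _; rewrite ler_nat ltnW.
  by rewrite ltr_pdivrMr//; lra.
Qed.

(** Accounts for one extra digit per level, available when the gap varies with the scale. *)
Lemma slopes_addw G alpha beta : slopes G alpha beta ->
  slopes (fun w => G w + w%:R) (1 + alpha) (1 + beta).
Proof.
move=> [G0 [C GC] Gsup Ginf].
split=> [w||eta w0 eta0|eta w0 eta0].
- by rewrite addr_ge0.
- by exists C => w; have /andP[] := GC w; lra.
- by have [w w0w] := Gsup eta w0 eta0; exists w => //; lra.
- by have [w w0w] := Ginf eta w0 eta0; exists w => //; lra.
Qed.

(** The coding bound needs [2 ^- v.+1 <= delta] and the separation bound needs [delta < 2 ^- v]; in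
    this interval both involve the same sum over [j < v.+1]. *)
Lemma dyadic_scale (delta : R) : 0 < delta -> delta < 1 ->
  exists v, 2 ^- v.+1 <= delta < 2 ^- v.
Proof.
move=> d0 d1; have [w wd] := exists_lt_2VX d0.
have ex : exists w, (2 ^- w : R) <= delta by exists w; exact: ltW.
case: (ex_minnP ex) => -[|v] vd vmin.
  by move: vd; rewrite expr0 invr1 leNgt d1.
exists v; rewrite vd ltNge /=; apply/negP => /vmin; lia.
Qed.

Lemma ln_dyadic_scale (v : nat) (delta : R) : 2 ^- v.+1 <= delta < 2 ^- v ->
  v%:R * ln 2 < ln (1 / delta) <= v.+1%:R * ln 2.
Proof.
move=> /andP[vd dv]; have d0 : 0 < delta.
  by apply: lt_le_trans vd; rewrite invr_gt0 exprn_gt0.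
rewrite div1r !mulr_natl -!lnXn//.
rewrite ltr_ln ?posrE ?exprn_gt0 ?invr_gt0//.
rewrite ler_ln ?posrE ?exprn_gt0 ?invr_gt0//.
rewrite -[X in X < _]invrK ltf_pV2 ?posrE ?invr_gt0 ?exprn_gt0// dv /=.
by rewrite -[X in _ <= X]invrK lef_pV2 ?posrE ?invr_gt0 ?exprn_gt0.
Qed.

Lemma near_dyadic (v0 : nat) (P : R -> Prop) :
  (forall v delta, (v0 <= v)%N -> 2 ^- v.+1 <= delta < 2 ^- v -> P delta) ->
  (0 : R)^'+ P.
Proof.
move=> H; near=> d; have d0 : 0 < d by near: d; exact: nbhs_right_gt.
have d1 : d < 2 ^- v0.
  by near: d; apply: nbhs_right_lt; rewrite invr_gt0 exprn_gt0.
have [|v vd] := dyadic_scale d0.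
  apply: lt_le_trans d1 _; by rewrite invf_le1 ?exprn_gt0// exprn_ege1// ler1n.
apply: (H v d) => //; move/andP: vd => [vd _].
by have := le_lt_trans vd d1; rewrite ltNge ler_2VX; lia.
Unshelve. all: by end_near. Qed.

Lemma dyadic_near (A : set R) : (0 : R)^'+ A ->
  exists v0, forall v, (v0 <= v)%N -> A (2 ^- v).
Proof.
move=> [e /= e0 eA]; have [w we] := exists_lt_2VX e0.
exists w => v wv; apply: eA; last by rewrite invr_gt0 exprn_gt0.
rewrite /ball /= sub0r normrN ger0_norm ?invr_ge0 ?exprn_ge0//.
by apply: le_lt_trans we; rewrite ler_2VX.
Qed.

Lemma slopes_upper G alpha beta g : slopes G alpha beta ->
  (forall v delta, 2 ^- v.+1 <= delta < 2 ^- v ->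
    (g delta <= (G v.+1 * ln 2 / ln (1 / delta))%:E)%E) ->
  (limf_esup g 0^'+ <= beta%:E)%E /\ (limf_einf g 0^'+ <= alpha%:E)%E.
Proof.
move=> [G0 [C GC] _ Ginf] gG.
have ln20 : 0 < ln (2 : R) by rewrite ln_gt0// ltr1n.
split.
  apply: limf_esup_le => eta eta0.
  (* The denominator is bounded through [v] while [G] is taken at [v.+1]; the excess [beta + C] is
     below [eta * v]. *)
  apply: (@near_dyadic (Num.truncn ((beta + C) / eta)).+1) => v delta v0' vd.
  have v0 : (beta + C) / eta < v%:R.
    by apply: lt_le_trans (truncnS_gt _) _; rewrite ler_nat.
  have /andP[vL _] := ln_dyadic_scale vd; have /andP[_ GvC] := GC v.+1.
  apply: le_trans (gG _ _ vd) _; rewrite lee_fin.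
  have v1 : 0 < v%:R :> R by rewrite ltr0n; exact: leq_trans v0'.
  have L0 : 0 < ln (1 / delta) by apply: le_lt_trans vL; rewrite mulr_ge0// ltW.
  rewrite ler_pdivrMr//; rewrite ltr_pdivrMr// in v0; rewrite -natr1 in GvC.
  have Gv : G v.+1 <= (beta + eta) * v%:R by lra.
  have be0 : 0 <= beta + eta by rewrite -(pmulr_lge0 _ v1) (le_trans (G0 v.+1)).
  apply: le_trans (ler_wpM2r (ltW ln20) Gv) _.
  by rewrite -mulrA ler_wpM2l// ltW.
apply: limf_einf_le => A eta /dyadic_near[v0 v0A] eta0.
have [[|w] w0 Gw] := Ginf eta v0 eta0; first by [].
(* At this scale [ln (1 / delta)] is exactly [w.+1] times [ln 2], so rounding costs nothing. *)
exists (2 ^- w.+1); first by apply: v0A; exact: ltnW.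
have wd : 2 ^- w.+1 <= (2 ^- w.+1 : R) < 2 ^- w.
  by rewrite lexx /= ltNge ler_2VX ltnn.
apply: le_trans (gG _ _ wd) _; rewrite lee_fin.
rewrite div1r invrK lnXn// -(mulr_natl (ln 2)) ler_pdivrMr ?mulr_gt0// mulrA.
by rewrite ler_wpM2r// ltW.
Qed.

Lemma slopes_lower G alpha beta g : slopes G alpha beta ->
  (forall eta, 0 < eta -> exists v0, forall v delta, (v0 <= v)%N ->
    2 ^- v.+1 <= delta < 2 ^- v ->
    ((G v.+1 / v.+1%:R - eta)%:E <= g delta)%E) ->
  (beta%:E <= limf_esup g 0^'+)%E /\ (alpha%:E <= limf_einf g 0^'+)%E.
Proof.
move=> [G0 [C GC] Gsup _] gG; split.
  apply: limf_esup_ge => A eta /dyadic_near[v0 v0A] eta0.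
  have e20 : 0 < eta / 2 by rewrite divr_gt0.
  have [v1 v1g] := gG _ e20.
  have [[|w]] := Gsup _ (maxn v0 v1) e20; first by [].
  rewrite ltnS geq_max => /andP[v0w v1w] Gw.
  exists (2 ^- w.+1); first by apply: v0A; exact: leqW.
  have wd : 2 ^- w.+1 <= (2 ^- w.+1 : R) < 2 ^- w.
    by rewrite lexx /= ltNge ler_2VX ltnn.
  apply: le_trans (v1g _ _ v1w wd); rewrite lee_fin.
  by move: Gw; rewrite -ler_pdivlMr//; move: (G w.+1 / _) => t; lra.
apply: limf_einf_ge => eta eta0.
have e20 : 0 < eta / 2 by rewrite divr_gt0.
have [v1 v1g] := gG _ e20.
apply: (@near_dyadic (maxn v1 (Num.truncn (C / (eta / 2))).+1)) => v delta.
rewrite geq_max => /andP[v1v Cv] vd.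
have {}Cv : C / (eta / 2) < v.+1%:R.
  by apply: lt_le_trans (truncnS_gt _) _; rewrite ler_nat ltnW.
apply: le_trans (v1g _ _ v1v vd); rewrite lee_fin.
have /andP[GvC _] := GC v.+1; rewrite ltr_pdivrMr// in Cv.
have : alpha - eta / 2 <= G v.+1 / v.+1%:R by rewrite ler_pdivlMr//; lra.
by move: (G v.+1 / _) => t; lra.
Qed.

End slopes.

(** * An oscillating integer gauge built from factorials *)

Definition fact_floor (w : nat) : nat := \max_(m < w.+1 | (m`! <= w)%N) m`!.

Lemma fact_floor_le w : (fact_floor w <= w)%N.
Proof. by apply/bigmax_leqP. Qed.

Lemma fact_floor_homo : {homo fact_floor : v w / (v <= w)%N}.
Proof.
move=> v w vw; apply/bigmax_leqP => m mv.
have mw : (m < w.+1)%N by apply: leq_trans (ltn_ord m) _.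
by apply: (leq_bigmax_cond (Ordinal mw)); exact: leq_trans mv vw.
Qed.

Lemma fact_floor_fact m : fact_floor m`! = m`!.
Proof.
apply/eqP; rewrite eqn_leq fact_floor_le /=.
have mm : (m < m`!.+1)%N by rewrite ltnS fact_geq.
exact: (leq_bigmax_cond (Ordinal mm)).
Qed.

(** Quotients of consecutive factorials are unbounded: [(m + 1)! - 1] is at least [m] times [m!], so
    just before a new factorial the ratio [fact_floor w / w] is small. *)
Lemma fact_floor_pred m : (fact_floor (m.+1`!).-1 <= m`!)%N.
Proof.
apply/bigmax_leqP => i im; have [mi|//] := ltnP m i; last exact: leq_fact.
have := leq_trans (leq_fact mi) im; have := fact_gt0 m.+1; lia.
Qed.

Section gauge.
Context {R : realType} (a b : R).
Hypotheses (a0 : 0 <= a) (ab : a <= b).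

(* fact_floor w / w is 1 at w = m! and tends to 0 along w = m! - 1. *)
Definition gauge (w : nat) : nat :=
  Num.truncn (a * w%:R + (b - a) * (fact_floor w)%:R).

Lemma gauge_homo : {homo gauge : v w / (v <= w)%N}.
Proof.
move=> v w vw; apply: le_truncn.
by rewrite lerD// ler_wpM2l ?subr_ge0// ler_nat// fact_floor_homo.
Qed.

Lemma gauge_bounds w :
  a * w%:R + (b - a) * (fact_floor w)%:R - 1 <= (gauge w)%:R
    <= a * w%:R + (b - a) * (fact_floor w)%:R.
Proof.
rewrite /gauge; set t := a * _ + _.
have t0 : 0 <= t by rewrite addr_ge0// mulr_ge0// subr_ge0.
by have /andP[tl] := truncn_itv t0; rewrite -natr1 => tr; lra.
Qed.

Lemma gauge_le w : (gauge w)%:R <= b * w%:R.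
Proof.
have /andP[_ gr] := gauge_bounds w.
have : (b - a) * (fact_floor w)%:R <= (b - a) * w%:R.
  by rewrite ler_wpM2l ?subr_ge0// ler_nat fact_floor_le.
lra.
Qed.

Lemma gauge_slopes : slopes (fun w => (gauge w)%:R) a b.
Proof.
have ba0 : 0 <= b - a by rewrite subr_ge0.
split=> [//||eta w0 eta0|eta w0 eta0].
- exists 1 => w; have /andP[gl gr] := gauge_bounds w.
  have p0 : 0 <= (b - a) * (fact_floor w)%:R by rewrite mulr_ge0.
  have := gauge_le w; lra.
(* At [m!] the gauge is at least [b * m! - 1], and [m > eta^-1] makes this 1 smaller than
   [eta * m!]. *)
- pose m := (maxn w0 (Num.truncn eta^-1)).+1.
  exists m`!; first by rewrite (leq_trans _ (fact_geq m))// ltnS leq_maxl.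
  have /andP[gl _] := gauge_bounds m`!; rewrite fact_floor_fact in gl.
  have : eta^-1 < m`!%:R.
    apply: lt_le_trans (truncnS_gt _) _; rewrite ler_nat.
    by apply: leq_trans (fact_geq m); rewrite ltnS leq_maxr.
  rewrite -(ltr_pM2l eta0) divff ?gt_eqF//; lra.
(* At [(m + 1)! - 1] the oscillating term is at most [(b - a) * m!], hence at most [eta * m * m!] by
   the choice of [m]. *)
- pose m := (maxn w0 (Num.truncn ((b - a) / eta))).+1.
  have mE : (m.+1`!).-1.+1 = (m * m`! + m`!)%N.
    by rewrite prednK ?fact_gt0// factS mulSn addnC.
  have m1 := fact_gt0 m.
  have mw : (m * m`! <= (m.+1`!).-1)%N by lia.
  exists (m.+1`!).-1.
    apply: leq_trans mw; apply: leq_trans (leq_pmulr _ _) => //.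
    by rewrite ltnS leq_maxl.
  have /andP[_ gr] := gauge_bounds (m.+1`!).-1; apply: le_trans gr _.
  rewrite [leRHS]mulrDl lerD2l.
  have bam : b - a <= eta * m%:R.
    rewrite -ler_pdivrMl// mulrC; apply/ltW/(lt_le_trans (truncnS_gt _)).
    by rewrite ler_nat ltnS leq_maxr.
  apply: (@le_trans _ _ ((b - a) * m`!%:R)).
    by rewrite ler_wpM2l// ler_nat fact_floor_pred.
  apply: (@le_trans _ _ (eta * m%:R * m`!%:R)); first by rewrite ler_wpM2r.
  by rewrite -mulrA -natrM ler_wpM2l ?(ltW eta0)// ler_nat.
Qed.

End gauge.

(** * Numbers of digits allotted to each gap and level *)

Section digits.
Variables (F : nat -> nat) (F_homo : {homo F : v w / (v <= w)%N}).

(** The increments of [F] telescope over the levels. The cutoff [k * k] keeps the extra digits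
    finite in number for each [k], yet lets them reach scales much larger than [k]. *)
Definition digits (k j : nat) : nat :=
  if (0 < k <= j)%N then (F j.+1 - F j + (j < k * k))%N else 0%N.

Lemma digits_supp k j : (0 < digits k j)%N -> (0 < k <= j)%N.
Proof. by rewrite /digits; case: ifP. Qed.

Lemma sum_digits_le k w :
  (\sum_(j < w) digits k j <= F w + minn w (k * k))%N.
Proof.
elim: w => [|w IH]; first by rewrite big_ord0.
rewrite big_ord_recr /=; move: (\sum_(j < w) _)%N IH => S IH.
rewrite /digits; have := F_homo (leqnSn w).
by case: ifP => _; case: (ltnP w (k * k)); lia.
Qed.

(** The levels below [k] are empty, which costs at most [F k] in increments and [k] in extra
    digits. *)
Lemma sum_digits_ge k w : (0 < k)%N ->
  (F w + minn w (k * k) <= \sum_(j < w) digits k j + (F k + k))%N.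
Proof.
move=> k0; elim: w => [|w IH].
  by rewrite big_ord0 min0n addn0; have := F_homo (leq0n k); lia.
rewrite big_ord_recr /=; move: (\sum_(j < w) _)%N IH => S IH.
rewrite /digits k0 /=; have Fw := F_homo (leqnSn w).
case: (leqP k w) => kw; first by case: (ltnP w (k * k)); lia.
by have := F_homo kw; lia.
Qed.

End digits.

(** * The entropy ratio at dyadic scales *)

Section entropy_ratio.
Context (R : realType) (E : nat -> nat -> nat).
Hypothesis E_supp : forall k j, (0 < E k j)%N -> (0 < k <= j)%N.
Local Notation T := (@shift R E 1).
Variables (eps : R) (eps_lt1 : eps < 1).

Lemma ln_inv_gt0 (v : nat) (delta : R) : 2 ^- v.+1 <= delta < 2 ^- v ->
  0 < ln (1 / delta).
Proof.
move=> /ln_dyadic_scale/andP[+ _]; apply: le_lt_trans.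
by rewrite mulr_ge0// ln_ge0// ler1n.
Qed.

Lemma q_ratio_le x : exists k, forall v delta, 2 ^- v.+1 <= delta < 2 ^- v ->
  (q_ratio T eps x delta <=
     ((\sum_(j < v.+1) E k j)%:R * ln 2 / ln (1 / delta))%:E)%E.
Proof.
have [k kP] := s_sep_Gamma_le E_supp x eps_lt1; exists k => v delta vd.
rewrite EFinM /q_ratio lee_pmul2r//; last first.
  by rewrite lte_fin invr_gt0 (ln_inv_gt0 vd).
pose c := (v.+1 + (v.+1 + v.+1) * \sum_(j < v.+1) E k j)%N.
apply: (h_top_le (c := c)) => n; rewrite /c.
have /andP[vd1 _] := vd; have := kP v.+1 n delta vd1.
by rewrite mulnDl [X in (v.+1 + X)%N]addnC addnA.
Qed.

Lemma q_ratio_ge k : (0 < k)%N -> 2 ^- k <= eps ->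
  exists x, forall v delta, 2 ^- v.+1 <= delta < 2 ^- v ->
  (((\sum_(j < v.+1) E k j)%:R / v.+1%:R)%:E <= q_ratio T eps x delta)%E.
Proof.
move=> k0 keps; have [x xP] := s_sep_Gamma_ge E_supp k0 keps.
exists x => v delta vd; have L0 := ln_inv_gt0 vd.
have ln20 : 0 < ln (2 : R) by rewrite ln_gt0// ltr1n.
have /andP[_ Lv] := ln_dyadic_scale vd.
apply: (@le_trans _ _ ((\sum_(j < v.+1) E k j)%:R * ln 2 / ln (1 / delta))%:E).
  rewrite lee_fin ler_pdivlMr// -mulrA ler_wpM2l// mulrC ler_pdivrMr//.
  by rewrite [leRHS]mulrC.
rewrite EFinM /q_ratio lee_pmul2r//; last by rewrite lte_fin invr_gt0.
by apply: h_top_ge => n; apply: xP; case/andP: vd.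
Qed.

End entropy_ratio.

Lemma ratio_le (R : realType) (G N c eta w : R) :
  0 < w -> G <= N + c -> c <= eta * w -> G / w - eta <= N / w.
Proof.
by move=> w0 GN cw; rewrite lerBlDr ler_pdivrMr// mulrDl divfK ?gt_eqF//; lra.
Qed.

(** * Bounds for the four dimensions *)

Section local_entropy_dimensions.
Context (R : realType) (a b : R).
Hypotheses (a0 : 0 <= a) (ab : a <= b).
Local Notation F := (gauge a b).
Local Notation E := (digits F).
Local Notation X := (space R E).
Local Notation T := (@shift R E 1).
Let E_supp := @digits_supp F.
Let F_homo := gauge_homo a0 ab.
Implicit Type eps : R.

(** A fixed point has a fixed [k], so its extra digits add up to at most the constant [k * k]. *)
Lemma D_ext_le eps x : eps < 1 ->
  (limf_esup (q_ratio T eps x) 0^'+ <= b%:E)%E /\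
  (limf_einf (q_ratio T eps x) 0^'+ <= a%:E)%E.
Proof.
move=> eps_lt1; have [k kP] := q_ratio_le E_supp eps_lt1 x.
apply: (slopes_upper (slopes_addc (k * k) (gauge_slopes a0 ab))) => v delta vd.
apply: le_trans (kP _ _ vd) _; rewrite lee_fin ler_wpM2r//.
  by rewrite invr_ge0 ltW// (ln_inv_gt0 vd).
rewrite ler_wpM2r ?ln_ge0 ?ler1n// -natrD ler_nat.
by apply: leq_trans (sum_digits_le F_homo k v.+1) _; rewrite leq_add2l geq_minr.
Qed.

(** One point serves all scales, since its loss [F k + k] is constant. *)
Lemma D_ext_ge eps : 0 < eps -> exists x,
  (b%:E <= limf_esup (q_ratio T eps x) 0^'+)%E /\
  (a%:E <= limf_einf (q_ratio T eps x) 0^'+)%E.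
Proof.
move=> eps_gt0; have [k0 k0eps] := exists_lt_2VX eps_gt0.
have keps : 2 ^- k0.+1 <= eps by apply: le_trans (ltW k0eps); rewrite ler_2VX.
have [x xP] := q_ratio_ge E_supp (ltn0Sn k0) keps.
exists x; apply: (slopes_lower (gauge_slopes a0 ab)) => eta eta0.
set k := k0.+1 in keps xP.
exists (Num.truncn ((F k + k)%:R / eta)).+1 => v delta v0 vd.
apply: le_trans (xP _ _ vd); rewrite lee_fin.
have {}v0 : (F k + k)%:R / eta < v.+1%:R.
  by apply: lt_le_trans (truncnS_gt _) _; rewrite ler_nat ltnW.
apply: (@ratio_le _ _ _ (F k + k)%:R) => //.
  rewrite -natrD ler_nat; have := sum_digits_ge F_homo v.+1 (ltn0Sn k0).
  by rewrite -/k; apply: leq_trans; rewrite leq_addr.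
by rewrite -ler_pdivrMl// mulrC ltW.
Qed.

(** Here [k] varies with the point, and the uniform bound on the extra digits is one per level. *)
Lemma D_int_le eps : eps < 1 ->
  (D_int_upper T eps <= (1 + b)%:E)%E /\
  (D_int_lower T eps <= (1 + a)%:E)%E.
Proof.
move=> eps_lt1.
apply: (slopes_upper (slopes_addw (gauge_slopes a0 ab))) => v delta vd.
apply: ge_ereal_sup => _ [x _ <-]; have [k kP] := q_ratio_le E_supp eps_lt1 x.
apply: le_trans (kP _ _ vd) _; rewrite lee_fin ler_wpM2r//.
  by rewrite invr_ge0 ltW// (ln_inv_gt0 vd).
rewrite ler_wpM2r ?ln_ge0 ?ler1n// -natrD ler_nat.
by apply: leq_trans (sum_digits_le F_homo k v.+1) _; rewrite leq_add2l geq_minl.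
Qed.

Lemma D_int_ge eps : 0 < eps ->
  ((1 + b)%:E <= D_int_upper T eps)%E /\
  ((1 + a)%:E <= D_int_lower T eps)%E.
Proof.
move=> eps_gt0.
apply: (slopes_lower (slopes_addw (gauge_slopes a0 ab))) => eta eta0.
have b0 : 0 <= b by exact: le_trans ab.
have [k0 k0eps] := exists_lt_2VX eps_gt0.
pose c := (b + 1) / eta.
(* Below [k] is at most [2 * w / M], so the loss [F k + k <= (b + 1) * k] is at most [eta * w] once
   [M > 2 * c]; [M >= k0] secures [2 ^- k <= eps]. *)
pose M := maxn k0 (Num.truncn (2 * c)).+1.
have M0 : (0 < M)%N by rewrite /M; lia.
have cM : 2 * c < M%:R.
  by apply: lt_le_trans (truncnS_gt _) _; rewrite ler_nat leq_maxr.
exists (M * M)%N => v delta Mv vd; set w := v.+1.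
(* As [M * M <= v], this gives [M <= k] and [w <= k * M <= k * k]: the cutoff of the extra digits is
   not reached before [w]. *)
pose k := (w %/ M).+1.
have Mk : (M <= k)%N.
  by rewrite /k leqW// leq_divRL// /w leqW.
have wk : (w <= k * k)%N.
  apply: (@leq_trans (k * M)); last by rewrite leq_mul2l Mk orbT.
  by rewrite ltnW// ltn_ceil.
have k1 : (0 < k)%N by [].
have keps : 2 ^- k <= eps.
  by apply: le_trans (ltW k0eps); rewrite ler_2VX (leq_trans _ Mk)// leq_maxl.
have [x xP] := q_ratio_ge E_supp k1 keps.
apply: le_trans (le_trans (xP _ _ vd) (ereal_sup_ubound _)); last by exists x.
rewrite lee_fin; apply: (@ratio_le _ _ _ (F k + k)%:R) => //.
  rewrite -!natrD ler_nat; have := sum_digits_ge F_homo w k1.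
  by rewrite (minn_idPl wk).
have kM : (k * M <= w + w)%N.
  rewrite /k mulSn addnC leq_add ?leq_trunc_div//.
  by rewrite (leq_trans _ (leqW Mv))// leq_pmulr.
have {}kM : k%:R * M%:R <= w%:R + w%:R :> R by rewrite -natrM -natrD ler_nat.
have k0R : 0 <= k%:R :> R by [].
have := gauge_le a0 ab k; rewrite natrD.
rewrite /c mulrA ltr_pdivrMr// in cM.
have := ler_wpM2r k0R (ltW cM); nra.
Qed.

End local_entropy_dimensions.

Lemma exists_local_entropy_dimensions (R : realType) (a b : R) :
  0 <= a -> a <= b ->
  exists (X : metricType R) (T : X -> X),
    is_Zaction T /\
    forall eps : R, 0 < eps -> eps < 1 ->
      [/\ D_int_upper T eps = (1 + b)%:E,
          D_int_lower T eps = (1 + a)%:E,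
          D_ext_upper T eps = b%:E
        & D_ext_lower T eps = a%:E].
Proof.
move=> a0 ab; pose E := digits (gauge a b).
exists (space R E), (@shift R E 1); split.
  split; [exact: space_nonempty| |exact: shift_homeo].
  exact/space_compact/digits_supp.
move=> eps eps0 eps1.
have [iu il] := D_int_le a0 ab eps1; have [iu' il'] := D_int_ge a0 ab eps0.
have [x [eu el]] := D_ext_ge a0 ab eps0.
have e_le y := D_ext_le a0 ab y eps1.
split; apply/eqP; rewrite eq_le ?iu ?il //; apply/andP; split => //.
- by apply: ge_ereal_sup => _ [y _ <-]; case: (e_le y).
- by apply: le_trans eu _; apply: ereal_sup_ubound; exists x.
- by apply: ge_ereal_sup => _ [y _ <-]; case: (e_le y).
- by apply: le_trans el _; apply: ereal_sup_ubound; exists x.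
Qed.

Theorem theorem2p6 (R : realType) :
  (forall a b : R, 0 <= a -> a <= b ->
    exists (X : metricType R) (T : X -> X),
      is_Zaction T /\
      forall eps : R, 0 < eps -> eps < 1 ->
        [/\ D_int_upper T eps = (1 + b)%:E,
            D_int_lower T eps = (1 + a)%:E,
            D_ext_upper T eps = b%:E
          & D_ext_lower T eps = a%:E])
  /\
  (exists a b : R, [/\ 0 <= a, a <= b &
    exists (X : metricType R) (T : X -> X),
      is_Zaction T /\
      forall eps : R, 0 < eps -> eps < 1 ->
        [/\ D_int_upper T eps = (1 + b)%:E,
            D_int_lower T eps = (1 + a)%:E,
            D_ext_upper T eps = b%:E
          & D_ext_lower T eps = a%:E] /\
        uniq [:: D_int_upper T eps; D_int_lower T eps;
                 D_ext_upper T eps; D_ext_lower T eps]]).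
Proof.
split; first exact: exists_local_entropy_dimensions.
have a0 : 0 <= (0 : R) by [].
have ab : (0 : R) <= 2 by [].
(* The four values become 3, 1, 2, 0; with [b = 1] instead, [1 + a] and [b] would coincide. *)
exists 0, 2; split => //.
have [X [T [XT D]]] := exists_local_entropy_dimensions a0 ab.
exists X, T; split => // eps eps0 eps1.
have [D1 D2 D3 D4] := D eps eps0 eps1; split => //.
rewrite D1 D2 D3 D4 /= !inE !eqe !negb_or.
by repeat (apply/andP; split); rewrite //; apply/eqP; lra.
Qed.
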